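(* Let $n \ge 1$, let $A_L, A_R \in \mathbb{R}^{n \times n}$ and $b, c \in \mathbb{R}^n$, and suppose $A_R = A_L + p c^{\mathsf T}$ for some $p \in \mathbb{R}^n$. Let $g : \mathbb{R}^n \to \mathbb{R}^n$ be the piecewise-linear continuous map $$g(x) = \begin{cases} A_L x + b, & c^{\mathsf T} x < 0, \\ A_R x + b, & c^{\mathsf T} x \ge 0. \end{cases}$$ Suppose $\lambda \in \mathbb{R}$ is an eigenvalue of algebraic multiplicity one of $A_L$ and also an eigenvalue of algebraic multiplicity one of $A_R$. Let $u^{\mathsf T}$ and $v$ be left and right eigenvectors, respectively, of $A_R$ corresponding to $\lambda$, and suppose $c^{\mathsf T} v \ne 0$. Suppose also that $1$ is not an eigenvalue of $A_R$ (so in particular $\lambda \ne 1$). Let $X = (I - A_R)^{-1} b$ and $$\mathcal{M} = \left\{ x \in \mathbb{R}^n : u^{\mathsf T}(x - X) = 0 \right\}.$$ Then: (i) $\mathcal{M}$ is invariant under $g$, that is, $g(\mathcal{M}) \subseteq \mathcal{M}$. (ii) If $|\lambda| < 1$, then for every $x \in \mathbb{R}^n$ the distance from $g^k(x)$ to $\mathcal{M}$ tends to $0$ as $k \to \infty$. (iii) If $|\lambda| > 1$, then for every $x \in \mathbb{R}^n \setminus \mathcal{M}$ the distance from $g^k(x)$ to $\mathcal{M}$ tends to $\infty$ as $k \to \infty$. (iv) If $|\lambda| \ne 1$, then every bounded invariant set of $g$ is contained in $\mathcal{M}$.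
   Context: A left eigenvector of $A_R$ corresponding to $\lambda$ is a row vector $u^{\mathsf T}$, with $u \in \mathbb{R}^n$ non-zero, satisfying $u^{\mathsf T} A_R = \lambda u^{\mathsf T}$; a right eigenvector is a non-zero $v \in \mathbb{R}^n$ with $A_R v = \lambda v$. $I$ is the $n \times n$ identity matrix, $g^k$ is the $k$-th iterate of $g$, and distance is Euclidean distance. In (iv), a bounded invariant set of $g$ is a bounded set $S \subseteq \mathbb{R}^n$ with $g(S) = S$. The condition $A_R = A_L + p c^{\mathsf T}$ expresses continuity of $g$ on the switching manifold $\{x \in \mathbb{R}^n : c^{\mathsf T} x = 0\}$. *)

(* Defs.v *)
From HB Require Import structures.
From mathcomp Require Import all_boot all_order all_algebra.
From mathcomp Require Import all_classical all_reals.
From mathcomp Require Import topology normedtype sequences.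

Set Implicit Arguments.
Unset Strict Implicit.
Unset Printing Implicit Defensive.

Import Order.TTheory GRing.Theory Num.Theory.
Import numFieldNormedType.Exports.

Local Open Scope classical_set_scope.
Local Open Scope ring_scope.

Definition dotv (R : realType) (n : nat) (u x : 'cV[R]_n) : R :=
  (u^T *m x) 0 0.

(* The library norm on matrices is the sup norm, hence a separate definition. *)
Definition enorm (R : realType) (n : nat) (x : 'cV[R]_n) : R :=
  Num.sqrt (\sum_(i < n) x i 0 ^+ 2).

(* The infimum of the distances when S is nonempty; the junk value of [inf]
   on the empty set makes this 0 when S is empty. *)
Definition edist_to (R : realType) (n : nat)
    (x : 'cV[R]_n) (S : set 'cV[R]_n) : R :=
  inf [set enorm (x - y) | y in S].

Definition ebounded (R : realType) (n : nat) (S : set 'cV[R]_n) : Prop :=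
  exists r : R, forall x, S x -> enorm x <= r.

(* [eigenvalue] is defined through left eigenvectors; a square matrix has the
   same eigenvalues on both sides. The algebraic multiplicity is that of l as
   a root of the characteristic polynomial. *)
Definition simple_eigenvalue (R : realType) (n : nat)
    (A : 'M[R]_n) (l : R) : Prop :=
  eigenvalue A l /\ mup l (char_poly A) = 1%N.

Definition left_eigenvector (R : realType) (n : nat)
    (A : 'M[R]_n) (l : R) (u : 'cV[R]_n) : Prop :=
  u != 0 /\ u^T *m A = l *: u^T.

Definition right_eigenvector (R : realType) (n : nat)
    (A : 'M[R]_n) (l : R) (v : 'cV[R]_n) : Prop :=
  v != 0 /\ A *m v = l *: v.

Definition pwl_map (R : realType) (n : nat)
    (AL AR : 'M[R]_n) (b c : 'cV[R]_n) (x : 'cV[R]_n) : 'cV[R]_n :=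
  if dotv c x < 0 then AL *m x + b else AR *m x + b.

(* Main.v *)
Require Import Defs.
From HB Require Import structures.
From mathcomp Require Import all_boot all_order all_algebra.
From mathcomp Require Import all_classical all_reals.
From mathcomp Require Import topology normedtype sequences.
From mathcomp Require Import ring lra.

Set Implicit Arguments.
Unset Strict Implicit.
Unset Printing Implicit Defensive.

Import Order.TTheory GRing.Theory Num.Theory.
Import numFieldNormedType.Exports.

Local Open Scope classical_set_scope.
Local Open Scope ring_scope.

(** The function y(x) = u^T (x - X), which vanishes exactly on the hyperplane M,
    is multiplied by lambda at every step of g: y(g(x)) = lambda y(x)
    ([dotv_pwl_map]). This would be clear for the right branch alone, as u is a
    left eigenvector of AR. The point is that u is a left eigenvector of AL for
    lambda as well ([left_eigenvector_rank1_update]): AR - AL = p c^T, and since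
    c^T v is nonzero any left eigenvector of AL for lambda must annihilate p, so
    it is an eigenvector of AR, which by simplicity of lambda is a multiple of u.
    Simplicity is algebraic, whereas a one-dimensional eigenspace is what is
    used, hence [rank_eigenspace_le_mup].

    The distance from x to M is |y(x)| / |u| ([edist_to_hyperplane]), so along an
    orbit it is |lambda|^k times its initial value; this settles the invariance
    and both limits. Now let S be a bounded set with g(S) = S; y is bounded on S.
    If |lambda| > 1, the forward orbit of a point of S outside M would make y
    unbounded on S. If |lambda| < 1, each x in S is g^k(z) for some z in S, so
    |y(x)| is at most |lambda|^k times a constant for every k, and y(x) = 0. *)

(** * Geometric and algebraic multiplicity *)

(** Complete a basis of the eigenspace to an invertible matrix E, whose first r
    rows are left eigenvectors. The first r rows of E ('X - A) are then divisible
    by 'X - a, so det E times the characteristic polynomial is divisible by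
    ('X - a)^r. *)
Lemma rank_eigenspace_le_mup (F : fieldType) (n : nat) (A : 'M[F]_n) (a : F) :
  (\rank (eigenspace A a) <= mup a (char_poly A))%N.
Proof.
set V := eigenspace A a; set r := \rank V.
pose E := row_ebase V; pose Ep : 'M[{poly F}]_n := map_mx polyC E.
have eigE (i : 'I_n) : (i < r)%N -> row i E *m A = a *: row i E.
  move=> lt_ir; apply/eigenspaceP.
  have -> : row i E = row (Ordinal lt_ir) (row_base V).
    rewrite /row_base row_mul -/E; apply/rowP => j; rewrite !mxE.
    rewrite (bigD1 i) //= !mxE eqxx lt_ir mul1r big1 ?addr0 // => k neq_ki.
    rewrite !mxE /= eq_sym -val_eqE /= in neq_ki *.
    by rewrite (negbTE neq_ki) mul0r.
  by apply: submx_trans (row_sub _ _) _; rewrite eq_row_base.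
have rowEp (i : 'I_n) : (i < r)%N ->
    row i (Ep *m char_poly_mx A) = ('X - a%:P) *: row i Ep.
  move=> lt_ir; rewrite row_mul /char_poly_mx mulmxBr mul_mx_scalar.
  by rewrite /Ep -map_row -map_mxM eigE // map_mxZ -scalerBl.
pose d : 'rV[{poly F}]_n := \row_i (if (i < r)%N then 'X - a%:P else 1).
pose B : 'M[{poly F}]_n :=
  \matrix_i (if (i < r)%N then row i Ep else row i (Ep *m char_poly_mx A)).
have factE : Ep *m char_poly_mx A = diag_mx d *m B.
  apply/row_matrixP => i; rewrite [RHS]row_mul row_diag_mx -scalemxAl.
  rewrite -rowE rowK mxE.
  by case: ifP => [/rowEp //|_]; rewrite scale1r.
have detd : \det (diag_mx d) = ('X - a%:P) ^+ r.
  rewrite det_diag.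
  under eq_bigr do rewrite mxE.
  rewrite -big_mkcond /= -(big_ord_widen _ (fun=> 'X - a%:P) (rank_leq_col V)).
  by rewrite prodr_const card_ord.
have := congr1 (fun M => \det M) factE.
rewrite !det_mulmx detd det_map_mx -/(char_poly A) => eqdet.
rewrite mup_geq ?monic_neq0 ?char_poly_monic //.
have detE : \det E != 0 by rewrite -unitfE -unitmxE row_ebase_unit.
by rewrite -(dvdpZr _ _ detE) -mul_polyC eqdet dvdp_mulr.
Qed.

Lemma simple_eigenvector_unique (F : fieldType) (n : nat) (A : 'M[F]_n) (a : F)
    (u w : 'rV[F]_n) :
  mup a (char_poly A) = 1%N -> w != 0 -> w *m A = a *: w -> u *m A = a *: u ->
  exists t, u = t *: w.
Proof.
move=> mupA w0 /eigenspaceP wV /eigenspaceP uV; apply/sub_rVP.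
apply: submx_trans uV _.
rewrite -(mxrank_leqif_sup wV) eqn_leq mxrankS //= rank_rV w0.
by have := rank_eigenspace_le_mup A a; rewrite mupA.
Qed.

(** A left eigenvector w of AL satisfies w AR = a w + (w p) c^T. Pairing with v
    gives (w p) (c^T v) = 0, hence w p = 0: so w is also a left eigenvector of
    AR, and by simplicity it spans the same line as u. *)
Lemma left_eigenvector_rank1_update (R : realType) (n : nat)
    (AL AR : 'M[R]_n) (p c u v : 'cV[R]_n) (a : R) :
  AR = AL + p *m c^T -> eigenvalue AL a -> mup a (char_poly AR) = 1%N ->
  left_eigenvector AR a u -> right_eigenvector AR a v -> dotv c v != 0 ->
  u^T *m AL = a *: u^T.
Proof.
move=> eqA /eigenvalueP [w wL w0] mupA [u0 uR] [v0 vR] cv0.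
have wR : w *m AR = a *: w + (w *m p) *m c^T by rewrite eqA mulmxDr wL mulmxA.
have wp0 : w *m p = 0.
  have : w *m p *m (c^T *m v) = 0.
    have : w *m AR *m v = w *m (AR *m v) by rewrite mulmxA.
    rewrite wR vR mulmxDl -scalemxAl -scalemxAr !mulmxA => /eqP.
    by rewrite addrC -subr_eq0 addrK => /eqP.
  rewrite [c^T *m v]mx11_scalar mul_mx_scalar => /eqP.
  by rewrite scaler_eq0 (negbTE cv0) => /eqP.
have [|t ut] := simple_eigenvector_unique mupA w0 _ uR.
  by rewrite wR wp0 mul0mx addr0.
by rewrite ut -scalemxAl wL scalerA mulrC -scalerA.
Qed.

(** * Distance to a hyperplane *)

Section Euclidean.
Variables (R : realType) (n : nat).
Implicit Types u x y : 'cV[R]_n.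

Lemma dotvE u x : dotv u x = \sum_i u i 0 * x i 0.
Proof. by rewrite /dotv mxE; apply: eq_bigr => i _; rewrite mxE. Qed.

Lemma dotvD u x y : dotv u (x + y) = dotv u x + dotv u y.
Proof. by rewrite /dotv mulmxDr mxE. Qed.

Lemma dotvZ u (t : R) x : dotv u (t *: x) = t * dotv u x.
Proof. by rewrite /dotv -scalemxAr mxE. Qed.

Lemma dotvN u x : dotv u (- x) = - dotv u x.
Proof. by rewrite -scaleN1r dotvZ mulN1r. Qed.

Lemma enorm_ge0 x : 0 <= enorm x.
Proof. exact: sqrtr_ge0. Qed.

Lemma sqr_enorm x : enorm x ^+ 2 = dotv x x.
Proof.
rewrite sqr_sqrtr ?sumr_ge0 // => [|i _]; last exact: sqr_ge0.
by rewrite dotvE; apply: eq_bigr => i _; rewrite expr2.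
Qed.

Lemma enorm_gt0 x : x != 0 -> 0 < enorm x.
Proof.
move=> x0; rewrite lt_def enorm_ge0 andbT; apply: contra x0 => /eqP ex0.
have : \sum_i x i 0 ^+ 2 = 0.
  rewrite -[LHS]sqr_sqrtr; first by rewrite -/(enorm x) ex0 expr0n.
  by rewrite sumr_ge0 // => i _; exact: sqr_ge0.
move=> /psumr_eq0P sx0; apply/eqP/matrixP => i j; rewrite ord1 mxE.
by apply/eqP; rewrite -sqrf_eq0 sx0 // => k _; exact: sqr_ge0.
Qed.

Lemma enormZ (t : R) x : enorm (t *: x) = `|t| * enorm x.
Proof.
rewrite /enorm -sqrtr_sqr -sqrtrM ?sqr_ge0 // mulr_sumr; congr Num.sqrt.
by apply: eq_bigr => i _; rewrite mxE exprMn.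
Qed.

Lemma cauchy_schwarz u x : `|dotv u x| <= enorm u * enorm x.
Proof.
have [->|u0] := eqVneq u 0.
  by rewrite /dotv trmx0 mul0mx mxE normr0 mulr_ge0 ?enorm_ge0.
rewrite -ler_sqr ?nnegrE ?mulr_ge0 ?enorm_ge0 //.
rewrite real_normK ?num_real // exprMn !sqr_enorm.
have uu0 : 0 < dotv u u by rewrite -sqr_enorm exprn_gt0 ?enorm_gt0.
(* Division-free form of the square of the part of x orthogonal to u. *)
have : 0 <= \sum_i (dotv u u * x i 0 - dotv u x * u i 0) ^+ 2.
  by rewrite sumr_ge0 // => i _; exact: sqr_ge0.
have -> : \sum_i (dotv u u * x i 0 - dotv u x * u i 0) ^+ 2 =
    dotv u u * (dotv u u * dotv x x - dotv u x ^+ 2).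
  transitivity (dotv u u ^+ 2 * dotv x x - 2 * dotv u u * dotv u x * dotv u x
     + dotv u x ^+ 2 * dotv u u); last by ring.
  rewrite [in dotv x x]dotvE [X in _ - _ * X]dotvE [X in _ + _ * X]dotvE.
  rewrite !mulr_sumr -sumrB -big_split; apply: eq_bigr => i _ /=; ring.
by rewrite pmulr_rge0 // subr_ge0.
Qed.

(** Cauchy-Schwarz makes the right-hand side a lower bound of the distances; it
    is attained at the orthogonal projection of x. *)
Lemma edist_to_hyperplane u X x : u != 0 ->
  edist_to x [set y | dotv u (y - X) = 0] = `|dotv u (x - X)| / enorm u.
Proof.
move=> u0; have eu := enorm_gt0 u0.
have uu0 : dotv u u != 0 by rewrite -sqr_enorm expf_neq0 ?gt_eqF.
rewrite /edist_to; set S := (Z in inf Z).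
have lbS : lbound S (`|dotv u (x - X)| / enorm u).
  move=> _ [y /= yM <-]; rewrite ler_pdivrMr // mulrC.
  have -> : dotv u (x - X) = dotv u (x - y).
    by rewrite -{1}[x](subrK y) -addrA [LHS]dotvD yM addr0.
  exact: cauchy_schwarz.
pose t := dotv u (x - X) / dotv u u.
have St : S (`|dotv u (x - X)| / enorm u).
  exists (x - t *: u) => /=.
    by rewrite addrAC dotvD dotvN dotvZ mulfVK // subrr.
  rewrite opprB addrC subrK enormZ /t normrM normfV -sqr_enorm.
  rewrite (ger0_norm (exprn_ge0 2 (enorm_ge0 u))).
  by field; rewrite gt_eqF.
apply/eqP; rewrite eq_le; apply/andP; split.
  by apply: ge_inf => //; exists (`|dotv u (x - X)| / enorm u).
by apply: lb_le_inf => //; exists (`|dotv u (x - X)| / enorm u).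
Qed.

Lemma ebounded_dotv (S : set 'cV[R]_n) u X : ebounded S ->
  exists C, forall x, S x -> `|dotv u (x - X)| <= C.
Proof.
move=> [r Sr]; exists (enorm u * r + `|dotv u X|) => x /Sr xr.
rewrite dotvD dotvN; apply: le_trans (ler_normB _ _) _; rewrite lerD2r.
by apply: le_trans (cauchy_schwarz _ _) _; rewrite ler_wpM2l ?enorm_ge0.
Qed.
End Euclidean.

(** * Geometric sequences *)

Lemma cvg_norm_expr0 (R : realType) (a C : R) : `|a| < 1 ->
  `|a| ^+ k * C @[k --> \oo] --> (0 : R).
Proof.
move=> a1; rewrite -[X in _ --> X](mul0r C).
by apply: cvgMr_tmp; apply: (@cvg_expr _ `|a|); rewrite normr_id.
Qed.

Lemma cvg_norm_expr_pinfty (R : realType) (a C : R) : 1 < `|a| -> 0 < C ->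
  `|a| ^+ k * C @[k --> \oo] --> +oo.
Proof.
move=> a1 C0; apply/cvgryPge => B.
have ia1 : `| `|a|^-1 | < 1.
  by rewrite normfV normr_id invf_lt1 // (lt_trans _ a1).
have BC : 0 < C / (`|B| + 1) by rewrite divr_gt0 // ltr_wpDl.
have a0 k : 0 < `|a| ^+ k by rewrite exprn_gt0 // (lt_trans _ a1).
have /cvgr0Pnorm_lt/(_ _ BC) := cvg_expr ia1.
apply: filterS => k /=.
rewrite exprVn normfV normrX normr_id ltr_pdivlMr ?ltr_wpDl // mulrC.
rewrite ltr_pdivrMr // => /ltW h.
have := ler_norm B; nra.
Qed.

(** * The transverse coordinate of the map *)

Section Map.
Variables (R : realType) (n : nat) (AL AR : 'M[R]_n) (b c u : 'cV[R]_n) (a : R).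
Hypothesis (uL : u^T *m AL = a *: u^T) (uR : u^T *m AR = a *: u^T).
Hypothesis h1 : ~~ eigenvalue AR 1.
Let g := pwl_map AL AR b c.
Let X := invmx (1%:M - AR) *m b.

Lemma right_branch_fixpoint : X = AR *m X + b.
Proof.
have invA : 1%:M - AR \in unitmx.
  move: h1; rewrite /eigenvalue negbK kermx_eq0 row_free_unit => AU.
  by rewrite -[1%:M - AR]opprB -scaleN1r unitmxZ ?unitrN1.
have : (1%:M - AR) *m X = b by rewrite mulKVmx.
by rewrite mulmxBl mul1mx => <-; rewrite addrC subrK.
Qed.

(** With u a left eigenvector of both AL and AR, the form u^T A x is a u^T x for
    either branch matrix A, so the branch taken at x does not matter. The point X
    is fixed by the right branch, even when it lies on the left side, which is
    enough to determine u^T b. *)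
Lemma dotv_pwl_map x : dotv u (g x - X) = a * dotv u (x - X).
Proof.
have uA (A : 'M[R]_n) y : u^T *m A = a *: u^T -> dotv u (A *m y) = a * dotv u y.
  by move=> eA; rewrite /dotv mulmxA eA -scalemxAl mxE.
have uX : dotv u X = a * dotv u X + dotv u b.
  by rewrite {1}right_branch_fixpoint dotvD uA.
rewrite !dotvD !dotvN {1}uX /g /pwl_map.
by case: ifP => _; rewrite dotvD uA //; ring.
Qed.

Lemma dotv_iter k x : dotv u (iter k g x - X) = a ^+ k * dotv u (x - X).
Proof.
by elim: k => [|k IH] /=; rewrite ?mul1r // dotv_pwl_map IH exprS mulrA.
Qed.
End Map.

(** * Dynamics relative to the hyperplane *)

Theorem mainTheorem2 (R : realType) (n : nat) (hn : (1 <= n)%N)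
    (AL AR : 'M[R]_n) (b c : 'cV[R]_n)
    (hcont : exists p : 'cV[R]_n, AR = AL + p *m c^T)
    (lambda : R)
    (hL : simple_eigenvalue AL lambda) (hR : simple_eigenvalue AR lambda)
    (u v : 'cV[R]_n)
    (hu : left_eigenvector AR lambda u) (hv : right_eigenvector AR lambda v)
    (hcv : dotv c v != 0)
    (h1 : ~~ eigenvalue AR 1) :
  let g := pwl_map AL AR b c in
  let X := invmx (1%:M - AR) *m b in
  let M := [set x : 'cV[R]_n | dotv u (x - X) = 0] in
  [/\ g @` M `<=` M,
      `|lambda| < 1 ->
        forall x : 'cV[R]_n, edist_to (iter k g x) M @[k --> \oo] --> (0 : R),
      1 < `|lambda| ->
        forall x : 'cV[R]_n, ~ M x -> edist_to (iter k g x) M @[k --> \oo] --> +oo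
    & `|lambda| != 1 ->
        forall S : set 'cV[R]_n, ebounded S -> g @` S = S -> S `<=` M].
Proof.
move=> g X M; have [p eqA] := hcont; have [u0 uR] := hu.
have uL : u^T *m AL = lambda *: u^T.
  exact: left_eigenvector_rank1_update eqA (proj1 hL) (proj2 hR) hu hv hcv.
have step x : dotv u (g x - X) = lambda * dotv u (x - X).
  exact: dotv_pwl_map.
have iterE k x : dotv u (iter k g x - X) = lambda ^+ k * dotv u (x - X).
  exact: dotv_iter.
have distE k x : edist_to (iter k g x) M =
    `|lambda| ^+ k * (`|dotv u (x - X)| / enorm u).
  by rewrite edist_to_hyperplane // iterE normrM normrX mulrA.
have eu := enorm_gt0 u0.
split.
- by move=> _ [x xM <-]; rewrite /M /= step xM mulr0.
- move=> lam1 x; rewrite (funext (distE ^~ x)).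
  exact: cvg_norm_expr0.
- move=> lam1 x /eqP xM; rewrite (funext (distE ^~ x)).
  by apply: cvg_norm_expr_pinfty => //; rewrite divr_gt0 ?normr_gt0.
move=> lam1 S Sb gS x Sx; apply/eqP; apply: contraT => xM.
have [C SC] := ebounded_dotv u X Sb.
have nx0 : 0 < `|dotv u (x - X)| by rewrite normr_gt0.
have [lam_lt1|lam_gt1|lamE] := ltgtP `|lambda| 1; last first.
- by rewrite lamE eqxx in lam1.
- have fwd k : S (iter k g x).
    by elim: k => [|k IH] //=; rewrite -gS; exists (iter k g x).
  have /cvgryPgt /(_ C) [N _ /(_ N (leqnn N)) /=] :=
    cvg_norm_expr_pinfty lam_gt1 nx0.
  by rewrite ltNge -normrX -normrM -iterE SC.
(* For a contraction only backward orbits help: S = g(S) provides them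
   although g need not be injective. *)
- have back k : exists2 y, S y & iter k g y = x.
    elim: k => [|k [y Sy <-]]; first by exists x.
    by move: Sy; rewrite -{1}gS => -[z Sz <-]; exists z => //; rewrite -iterSr.
  have /cvgr0Pnorm_lt /(_ _ nx0) [N _ /(_ N (leqnn N)) /=] :=
    @cvg_norm_expr0 _ _ C lam_lt1.
  have [y Sy <-] := back N.
  rewrite ltNge iterE => /negP []; apply: le_trans _ (ler_norm _).
  by rewrite normrM normrX ler_wpM2l ?exprn_ge0 ?SC.
Qed.
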